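(* Let $\sigma,\tau\in\mathfrak{S}_n$. Then $R(\sigma)=R(\tau)$ if and only if there is a permutation $\rho\in\mathfrak{S}_n$ that can be obtained both from $\sigma$ and from $\tau$ by finite sequences of legal moves. Equivalently, the relation $\sigma\sim\tau \iff R(\sigma)=R(\tau)$ is the equivalence relation on $\mathfrak{S}_n$ generated by legal moves.
   Context: Patience Sorting: given $\sigma=\sigma_1\cdots\sigma_n\in\mathfrak{S}_n$, process $\sigma_1,\dots,\sigma_n$ in order, maintaining a left-to-right sequence of piles; $\sigma_1$ starts the first pile; each subsequent card is placed on top of the leftmost pile whose current top card is larger than it, and if no such pile exists it starts a new pile to the right of all existing piles. $R(\sigma)$ denotes the resulting sequence of piles (each a set of cards). A legal move on $\pi\in\mathfrak{S}_n$ (changing an occurrence of $2\mathrm{-}31$ not contained in an occurrence of $3\mathrm{-}1\mathrm{-}42$ into an occurrence of $2\mathrm{-}13$, i.e. changing a $3\mathrm{-}\bar{1}\mathrm{-}42$ pattern into a $3\mathrm{-}\bar{1}\mathrm{-}24$ pattern): choose indices $i<j<n$ with $\pi_{j+1}<\pi_i<\pi_j$ such that there is no $k$ with $i<k<j$ and $\pi_k<\pi_{j+1}$, and swap the entries in positions $j$ and $j+1$. *)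

(* Defs.v *)
From mathcomp Require Import all_boot all_fingroup.
From Stdlib Require Import Relation_Operators.

Set Implicit Arguments.
Unset Strict Implicit.
Unset Printing Implicit Defensive.

(* Positions and cards are numbered from 0, i.e., they range over 'I_n. *)

(* A pile is listed from its top card down, so that [head] is its top card. The
   default value of [head] plays no role, as empty piles never occur. *)
Fixpoint place (n : nat) (c : 'I_n) (piles : seq (seq 'I_n)) : seq (seq 'I_n) :=
  if piles is p :: piles' then
    if (c < head c p)%N then (c :: p) :: piles' else p :: place c piles'
  else [:: [:: c]].

Definition patience (n : nat) (cards : seq 'I_n) : seq (seq 'I_n) :=
  foldl (fun piles c => place c piles) [::] cards.

Definition word (n : nat) (s : 'S_n) : seq 'I_n := [seq s i | i <- enum 'I_n].

Definition R (n : nat) (s : 'S_n) : seq {set 'I_n} :=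
  [seq [set c in p] | p <- patience (word s)].

(* The product of permutations composes from left to right, so [tperm j j1 * p]
   is [p] with its entries at the positions j and j1 exchanged. *)
Definition legal_move (n : nat) (p q : 'S_n) : Prop :=
  exists i j j1 : 'I_n,
    [/\ j1 = j.+1 :> nat, (i < j)%N, (p j1 < p i < p j)%N,
        ~ (exists k : 'I_n, (i < k < j)%N /\ (p k < p j1)%N)
      & q = (tperm j j1 * p)%g].

Definition legal_moves (n : nat) : 'S_n -> 'S_n -> Prop :=
  clos_refl_trans 'S_n (@legal_move n).

Definition legal_equiv (n : nat) : 'S_n -> 'S_n -> Prop :=
  clos_refl_sym_trans 'S_n (@legal_move n).

(* Main.v *)
(** Two adjacent cards exchanged by a legal move go to different piles, because
    the pile holding the witness [pi_i] keeps a top card strictly between them;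
    hence the piles do not change. Conversely, legal moves turn every
    permutation into the word that reads its piles from left to right, each one
    from bottom to top: by induction on the number of cards, it suffices to
    append a card [x] to such a word. If [x] lands on a pile with top [b], then
    all the cards in the piles further right exceed [b], so [b] witnesses the
    legality of each of the swaps that carry [x] leftwards to its pile. *)

Require Import Defs.
From mathcomp Require Import all_boot all_fingroup.
From mathcomp Require Import zify.
From Stdlib Require Import Relation_Operators.

Set Implicit Arguments.
Unset Strict Implicit.
Unset Printing Implicit Defensive.

Lemma map_eq_cat (T1 T2 : Type) (f : T1 -> T2) s u v :
  map f s = u ++ v -> exists s1 s2, [/\ s = s1 ++ s2, map f s1 = u & map f s2 = v].
Proof.
move=> def; exists (take (size u) s), (drop (size u) s).
by rewrite cat_take_drop map_take map_drop def take_size_cat ?drop_size_cat.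
Qed.

Section Piles.
Variable n : nat.
Implicit Types (a b c x y : 'I_n) (p : seq 'I_n) (P : seq (seq 'I_n)).
Implicit Types (u v w : seq 'I_n).

(** * The shape of the piles of distinct cards *)

Definition ordlt : rel 'I_n := fun x y => (x < y)%N.

Lemma ordlt_trans : transitive ordlt.
Proof. by move=> y x z; apply: ltn_trans. Qed.

Lemma ordlt_irr : irreflexive ordlt.
Proof. by move=> x; apply: ltnn. Qed.

Lemma ord_neq_lt x y : x != y -> (x < y)%N || (y < x)%N.
Proof. by rewrite -neq_ltn. Qed.

(** Invariant of patience sorting on distinct cards. A top is compared with all cards further right,
    not only with the next top, because this is what makes it a witness for swaps. *)
Fixpoint layered P : bool :=
  if P is p :: P' then
    if p is t :: p' then
      [&& path ordlt t p', all (ordlt t) (flatten P') & layered P']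
    else false
  else true.

(* The reverse patience word of Burstein and Lankham. *)
Definition rpw P : seq 'I_n := flatten [seq rev p | p <- P].

Lemma perm_flatten_place c P : perm_eq (flatten (place c P)) (c :: flatten P).
Proof.
elim: P => [|p P IH] //=; case: ifP => _ //=.
rewrite perm_sym -cat1s perm_catCA perm_cat2l perm_sym; exact: IH.
Qed.

Lemma patience_rcons w c : patience (rcons w c) = place c (patience w).
Proof. by rewrite /patience foldl_rcons. Qed.

Lemma perm_flatten_patience w : perm_eq (flatten (patience w)) w.
Proof.
elim/last_ind: w => [|w c IH] //.
rewrite patience_rcons (perm_trans (perm_flatten_place _ _)) //.
by rewrite perm_sym perm_rcons perm_cons perm_sym.
Qed.

Lemma perm_rpw P : perm_eq (rpw P) (flatten P).
Proof.
elim: P => [|p P IH] //; rewrite /rpw /=.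
by apply: perm_cat; rewrite ?perm_rev.
Qed.

(** As cards are distinct, a card that passes a pile exceeds its top; a card that lands only lowers
    the top, so the bounds on the cards further right persist. *)
Lemma layered_place c P :
  c \notin flatten P -> layered P -> layered (place c P).
Proof.
elim: P => [|[|t p] P IH] //=.
rewrite inE mem_cat !negb_or => /and3P[ct cp cP] /and3P[tp tP lP].
case: ifP => [lt_ct|/negbT nlt_ct] /=.
  rewrite {1}/ordlt lt_ct tp lP /= andbT.
  by apply: sub_all tP => y; apply: ltn_trans.
rewrite tp IH //= andbT (perm_all _ (perm_flatten_place _ _)) /= tP andbT.
by have := ord_neq_lt ct; rewrite (negbTE nlt_ct).
Qed.

Lemma layered_patience w : uniq w -> layered (patience w).
Proof.
elim/last_ind: w => [|w c IH] //.
rewrite rcons_uniq patience_rcons => /andP[cw uw].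
by apply: layered_place; rewrite ?IH // (perm_mem (perm_flatten_patience w)).
Qed.

Lemma layered_sorted P p : layered P -> p \in P -> sorted ordlt p.
Proof.
elim: P => [|[|t q] P IH] //= /and3P[tq _ lP].
by rewrite inE => /predU1P[-> //|]; apply: IH.
Qed.

(** * Invariance of the piles under a swap *)

Definition has_top_in a b P : bool :=
  has (fun p => if p is t :: _ then (a < t <= b)%N else false) P.

Lemma layered_has_top_lt a b t P :
  all (ordlt t) (flatten P) -> has_top_in a b P -> (t < b)%N.
Proof.
move=> tP /hasP[[|s p] // /[swap] /andP[_ sb] spP].
have sP : s \in flatten P by apply/flattenP; exists (s :: p); rewrite ?inE ?eqxx.
by have := allP tP _ sP; rewrite /ordlt; lia.
Qed.

Lemma has_top_in_place_self a b P :
  (a < b)%N -> has_top_in a b (place b P).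
Proof.
move=> ab; elim: P => [|p P IH] /=; first by rewrite ab leqnn.
by case: ifP => _ /=; rewrite ?ab ?leqnn ?IH ?orbT.
Qed.

(** The witness [b] may get covered, but a card [y > a] that covers a top [t] with [a < t <= b]
    satisfies [a < y < t], so it takes over the role of [t]. *)
Lemma has_top_in_place a b y P :
  (a < y)%N -> has_top_in a b P -> has_top_in a b (place y P).
Proof.
move=> ay; elim: P => [|[|t p] P IH] //=.
  by case: ifP => //= _ hP; rewrite ?hP ?orbT ?IH.
case: ifP => [yt|_] /= /orP[h|h]; apply/orP; try by [right|left|right; apply: IH].
by left; lia.
Qed.

Lemma has_top_in_patience a b u u' :
  (a < b)%N -> all (ordlt a) u' -> has_top_in a b (patience (u ++ b :: u')).
Proof.
move=> ab; elim/last_ind: u' => [|u' y IH].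
  by rewrite cats1 patience_rcons has_top_in_place_self.
rewrite all_rcons => /andP[ay au'].
by rewrite -rcons_cons -rcons_cat patience_rcons has_top_in_place ?IH.
Qed.

(** Both cards pass the piles with top at most [a]. The first top [t] above [a] satisfies [t <= b]:
    it is the witness, or the witness lies further right and exceeds it. So [a] lands there, while
    [c] passes that pile whether or not [a] covers it. *)
Lemma placeC a b c P : (b < c)%N -> (a < b)%N -> layered P ->
  has_top_in a b P -> place a (place c P) = place c (place a P).
Proof.
move=> bc ab; elim: P => [|[|t p] P IH] //= /and3P[tp tP lP].
case: (ltnP a t) => [lt_at|le_ta] /=.
  move=> h; have tb : (t <= b)%N.
    by case/orP: h => [/= //|/(layered_has_top_lt tP)/ltnW].
  have -> : (c < t)%N = false by lia.
  have -> : (c < a)%N = false by lia.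
  by rewrite /= lt_at.
move=> /= hP; have -> : (c < t)%N = false by lia.
by rewrite /= ltnNge le_ta /= IH.
Qed.

(** A legal move read on words, which can be concatenated and extended card by card. Here [b], [c],
    [a] are the entries at positions i, j, j+1, and the condition on [u'] excludes the barred 1. *)
Inductive card_swap : seq 'I_n -> seq 'I_n -> Prop :=
  CardSwap u b u' c a v of (a < b < c)%N & all (ordlt a) u' :
    card_swap (u ++ b :: u' ++ c :: a :: v) (u ++ b :: u' ++ a :: c :: v).

Definition card_swaps := clos_refl_trans _ card_swap.

Lemma patience_card_swap w w' :
  uniq w -> card_swap w w' -> patience w = patience w'.
Proof.
move=> /[swap]; case=> u b u' c a v /andP[ab bc] au' uw.
rewrite -!cat_cons !catA in uw *.
have := has_top_in_patience u ab au'; move: (u ++ b :: u') uw => w0 uw top.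
rewrite /patience !foldl_cat /= -/(patience w0).
rewrite (placeC bc ab) //.
by apply: layered_patience; move: uw; rewrite cat_uniq => /andP[].
Qed.

(** * Reduction to the reverse patience word, and piles recovered from their sets *)

Lemma card_swaps_cat u v w w' :
  card_swaps w w' -> card_swaps (u ++ w ++ v) (u ++ w' ++ v).
Proof.
elim=> [_ _ []|w1|w1 w2 w3 _ IH1 _ IH2].
- move=> u1 b u2 c a v1 abc au2; apply: rt_step.
  rewrite -!(catA, cat_cons) (catA u) (catA u).
  exact: CardSwap.
- exact: rt_refl.
- exact: rt_trans IH1 IH2.
Qed.

(** The cards between [b] and the one being crossed exceed [b], hence [x], so none of them blocks a
    swap. *)
Lemma card_swaps_move_left b v x : (x < b)%N -> all (ordlt b) v ->
  card_swaps (b :: rcons v x) (b :: x :: v).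
Proof.
move=> xb; elim/last_ind: v => [|v c IH]; first by move=> _; apply: rt_refl.
rewrite all_rcons => /andP[bc bv].
apply: rt_trans (_ : card_swaps _ (b :: rcons (rcons v x) c)) _.
  apply: rt_step; rewrite -!cats1 -!catA.
  apply: (@CardSwap [::]); first by rewrite xb.
  by apply: sub_all bv => y; apply: ltn_trans.
by have := @card_swaps_cat [::] [:: c] _ _ (IH bv); rewrite /= !cats1.
Qed.

(** The top [t] ends the block of its pile in [rpw], so moving [x] right behind [t] puts it on that
    pile. The piles that [x] passes form an untouched prefix. *)
Lemma card_swaps_place x P : layered P -> x \notin flatten P ->
  card_swaps (rcons (rpw P) x) (rpw (place x P)).
Proof.
elim: P => [|[|t p] P IH] /=; [by move=> *; apply: rt_refl|by []|].
move=> /and3P[tp tP lP] xtpP; rewrite {1}/rpw /= rev_cons.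
case: ifP => [xt|_].
  rewrite /rpw /= !rev_cons -/(rpw P) rcons_cat cat_rcons -!cats1 -!catA /=.
  rewrite cats1 -[X in card_swaps (_ ++ X)]cats0.
  rewrite -[X in card_swaps _ (_ ++ X)]cats0.
  apply/card_swaps_cat/card_swaps_move_left => //.
  by rewrite (perm_all _ (perm_rpw P)).
rewrite /rpw /= -/(rpw P) -/(rpw (place x P)) ?rev_cons rcons_cat.
rewrite -[rcons (rpw P) x]cats0 -[rpw (place x P)]cats0.
apply/card_swaps_cat/IH => //.
by move: xtpP; rewrite inE mem_cat !negb_or => /and3P[].
Qed.

Lemma card_swaps_rpw w : uniq w -> card_swaps w (rpw (patience w)).
Proof.
elim/last_ind: w => [|w x IH]; first by move=> _; apply: rt_refl.
rewrite rcons_uniq patience_rcons => /andP[xw uw].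
apply: rt_trans (_ : card_swaps _ (rcons (rpw (patience w)) x)) _.
  by have := @card_swaps_cat [::] [:: x] _ _ (IH uw); rewrite /= !cats1.
apply: card_swaps_place; first exact: layered_patience.
by rewrite (perm_mem (perm_flatten_patience w)).
Qed.

(** Each pile is strictly increasing from its top down, hence determined by its set of cards. *)
Lemma layered_inj P Q : layered P -> layered Q ->
  [seq [set c in p] | p <- P] = [seq [set c in p] | p <- Q] -> P = Q.
Proof.
move=> lP lQ.
have {lP} : {in P, forall p, sorted ordlt p} by move=> p; apply: layered_sorted.
have {lQ} : {in Q, forall p, sorted ordlt p} by move=> p; apply: layered_sorted.
elim: P Q => [|p P IH] [|q Q] // sQ sP [pq PQ].
congr cons; last first.
  by apply: IH PQ => r rX; [apply: sQ|apply: sP]; rewrite inE rX orbT.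
apply: (irr_sorted_eq ordlt_trans ordlt_irr).
- by apply: sP; rewrite mem_head.
- by apply: sQ; rewrite mem_head.
- by move=> x; move/setP/(_ x): pq; rewrite !inE.
Qed.

(** * Legal moves on permutations as swaps on words *)

Lemma word_uniq (s : 'S_n) : uniq (word s).
Proof. by rewrite map_inj_uniq ?enum_uniq //; apply: perm_inj. Qed.

Lemma word_inj : injective (@word n).
Proof.
move=> s t /eq_in_map st; apply/permP => i.
by apply: st; rewrite mem_enum.
Qed.

Lemma enum_ord_sorted : sorted ordlt (enum 'I_n).
Proof. by have := iota_ltn_sorted 0 n; rewrite -val_enum_ord sorted_map. Qed.

Lemma enum_ord_cat_cons e x e' : enum 'I_n = e ++ x :: e' -> x = size e :> nat.
Proof.
move=> defe; rewrite -[LHS]index_enum_ord defe index_cat /= eqxx addn0.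
have := enum_uniq 'I_n; rewrite defe cat_uniq /= negb_or.
by move=> /and3P[_ /andP[/negbTE-> _] _].
Qed.

Lemma word_tperm (s : 'S_n) e j j1 e' : enum 'I_n = e ++ j :: j1 :: e' ->
  word (tperm j j1 * s)%g = map s e ++ s j1 :: s j :: map s e'.
Proof.
move=> defe; rewrite /word defe map_cat /= !permM tpermL tpermR.
have := enum_uniq 'I_n; rewrite defe cat_uniq /= !inE !negb_or.
move=> /and3P[_ /and3P[je j1e _] /andP[/andP[jj1 je'] /andP[j1e' _]]].
by congr (_ ++ [:: _, _ & _]); apply/eq_in_map => k ke; rewrite permM tpermD //;
  apply: contraTneq ke => <-.
Qed.

Lemma legal_move_card_swap (s t : 'S_n) :
  legal_move s t -> card_swap (word s) (word t).
Proof.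
case=> i [j [j1 [jj1 ij /andP[ab bc] nok ->]]].
(* The list of positions is cut at [j], then its prefix at [i]; mapping it cuts the word around the
   three cards. *)
have [e' defe] : exists e', enum 'I_n = take j (enum 'I_n) ++ j :: j1 :: e'.
  exists (drop j.+2 (enum 'I_n)).
  rewrite -{1}(cat_take_drop j (enum 'I_n)); congr (_ ++ _).
  rewrite (drop_nth i) ?size_enum_ord ?ltn_ord // nth_ord_enum -jj1.
  by rewrite (drop_nth i) ?size_enum_ord ?ltn_ord // nth_ord_enum jj1.
have : i \in take j (enum 'I_n) by rewrite in_take ?mem_enum // index_enum_ord.
have inj k : k \in take j (enum 'I_n) -> (k < j)%N.
  by rewrite in_take ?mem_enum // index_enum_ord.
case/splitPr deft: {1}_ / => [e0 e1]; rewrite deft in defe inj.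
rewrite (word_tperm _ defe) /word defe !map_cat /= -!catA /=.
apply: CardSwap; first by rewrite ab.
have lt_ik k : k \in e1 -> (i < k)%N.
  have := enum_ord_sorted; rewrite (sorted_pairwise ordlt_trans) defe -catA.
  rewrite pairwise_cat => /and3P[_ _] /= /andP[+ _] => /allP ie1 ke1.
  by apply: ie1; rewrite mem_cat ke1.
apply/allP => _ /mapP[k ke1 ->].
have kj : (k < j)%N by apply: inj; rewrite mem_cat inE ke1 !orbT.
(* Since [k < j1], injectivity separates the two cards, and [nok] then decides their order. *)
have := @ord_neq_lt (s k) (s j1); rewrite (inj_eq perm_inj) -val_eqE /= jj1.
case/(_ _)/orP => //; first by rewrite neq_ltn ltnS ltnW.
by move=> sk; case: nok; exists k; rewrite lt_ik.
Qed.

(** The decomposition of the word lifts through [map] to the list of positions, which supplies [i],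
    [j] and [j1]. *)
Lemma card_swap_legal_move (s : 'S_n) w :
  card_swap (word s) w -> exists2 t, legal_move s t & word t = w.
Proof.
move defw: (word s) => w0 sw; case: sw defw => u b u' c a v /andP[ab bc] au'.
case/map_eq_cat => e0 [[|i e] [defe defu //]] /= [defb].
case/map_eq_cat => e1 [[|j [|j1 e2]] [defe' defu' //]] /= [defc defa defv].
subst u b u' c a v e.
have := enum_ord_sorted; rewrite (sorted_pairwise ordlt_trans) defe.
rewrite pairwise_cat => /and3P[/allrelP e0i _] /= /andP[/allP ie].
rewrite pairwise_cat => /and3P[_ _] /andP[/allP je _].
(* A position equals the length of the prefix before it; the prefixes of [j] and [j1] differ by one
   entry. *)
have eqj := @enum_ord_cat_cons (e0 ++ i :: e1) j (j1 :: e2).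
have eqj1 := @enum_ord_cat_cons (e0 ++ i :: rcons e1 j) j1 e2.
rewrite defe -!catA /= cat_rcons in eqj eqj1.
have jj1 : j1 = j.+1 :> nat.
  by rewrite eqj ?eqj1 // !size_cat /= size_rcons !addnS.
exists (tperm j j1 * s)%g; last first.
  by rewrite (@word_tperm _ (e0 ++ i :: e1) _ _ e2) ?defe ?map_cat -?catA.
exists i, j, j1; split; rewrite ?ab ?jj1 //.
  by apply: ie; rewrite mem_cat mem_head orbT.
case=> k [/andP[ik kj] sk].
(* The list of positions increases, so everything outside [e1] violates [i < k < j]. *)
have : k \in e1.
  have := mem_enum 'I_n k; rewrite defe mem_cat inE mem_cat inE.
  case/or4P => // [ke0|/eqP eki|/predU1P[ekj|/je jk]].
  - by have := e0i _ _ ke0 (mem_head _ _); rewrite /ordlt ltnNge ltnW.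
  - by rewrite eki ltnn in ik.
  - by rewrite ekj ltnn in kj.
  - by rewrite /ordlt ltnNge ltnW in jk.
by move/(map_f s)/(allP au'); rewrite /ordlt ltnNge ltnW.
Qed.

Lemma card_swaps_legal_moves (s : 'S_n) w :
  card_swaps (word s) w -> exists2 t, legal_moves s t & word t = w.
Proof.
(* The induction is uniform in [s], as the second half of a chain starts from the permutation that
   the first half reaches. *)
move defw: (word s) => w0 sw; elim: sw s defw => [w1 w2 sw|w1|w1 w2 w3 _ IH1 _ IH2] s.
- move=> defw; rewrite -defw in sw.
  by have [t st defw2] := card_swap_legal_move sw; exists t => //; apply: rt_step.
- by exists s => //; apply: rt_refl.
- move=> /IH1[t st /IH2[r tr defw3]].
  by exists r => //; apply: rt_trans tr.
Qed.

(** * Equal piles, common targets and the generated equivalence *)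

Lemma eq_R_patience (s t : 'S_n) :
  R s = R t <-> patience (word s) = patience (word t).
Proof.
split=> [|eq_st]; last by rewrite /R eq_st.
by apply: layered_inj; apply/layered_patience/word_uniq.
Qed.

Lemma legal_equiv_R (s t : 'S_n) : legal_equiv s t -> R s = R t.
Proof.
elim=> [p q pq|p|p q _ ->|p q r _ -> _ ->] //.
apply/eq_R_patience/patience_card_swap; first exact: word_uniq.
exact: legal_move_card_swap.
Qed.

Lemma legal_moves_equiv (s t : 'S_n) : legal_moves s t -> legal_equiv s t.
Proof.
by elim=> [p q|p|p q r _ + _]; [apply: rst_step|apply: rst_refl|apply: rst_trans].
Qed.

Lemma common_legal_moves_equiv (s t r : 'S_n) :
  legal_moves s r -> legal_moves t r -> legal_equiv s t.
Proof.
move=> /legal_moves_equiv sr /legal_moves_equiv tr.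
by apply: rst_trans sr _; apply: rst_sym.
Qed.

(** The reverse patience word depends on the piles alone, so both reductions end at the same
    permutation. *)
Lemma eq_R_common_legal_moves (s t : 'S_n) : R s = R t ->
  exists r, legal_moves s r /\ legal_moves t r.
Proof.
move=> /eq_R_patience eqP.
have [r sr defr] := card_swaps_legal_moves (card_swaps_rpw (word_uniq s)).
have [q tq defq] := card_swaps_legal_moves (card_swaps_rpw (word_uniq t)).
exists r; split=> //.
by have -> : r = q by apply: word_inj; rewrite defr defq eqP.
Qed.

End Piles.

Theorem mainTheorem2 (n : nat) (sigma tau : 'S_n) :
  (R sigma = R tau <->
     exists rho : 'S_n, legal_moves sigma rho /\ legal_moves tau rho) /\
  (R sigma = R tau <-> legal_equiv sigma tau).
Proof.
have sound := @legal_equiv_R n sigma tau.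
have complete := @eq_R_common_legal_moves n sigma tau.
split; split=> //.
- by move=> [rho [s_rho t_rho]]; apply/sound/(common_legal_moves_equiv s_rho).
- by move=> /complete[rho [s_rho t_rho]]; apply: common_legal_moves_equiv t_rho.
Qed.
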